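(* Fix a constant $\eta\in(0,1)$. Consider group testing with the i.i.d. Bernoulli test design with parameter $\nu$ chosen such that $(1-\frac{\nu}{k})^k=\frac12$, and suppose that $n\le(1-\eta)\log_2\binom{p}{k}$. Then, when $k=k(p)$ satisfies $k\to\infty$ with $k=o\big(p^{\frac{\eta}{1+\eta}}\big)$ as $p\to\infty$, for any fixed $\alpha\in(0,1)$, any decoder that outputs some estimate $\hat S$ of $S$ must yield, as $p\to\infty$, $$ \mathbb{P}\Big[\max\big\{|\hat S\setminus S|,|S\setminus\hat S|\big\}\le\alpha k\Big]\to0. $$
   Context: Probabilistic (noiseless) group testing: there are $p$ items $\{1,\dots,p\}$, and the defective set $S$ is uniformly distributed over the $\binom{p}{k}$ subsets of $\{1,\dots,p\}$ of cardinality $k$. I.i.d. Bernoulli design: the test matrix $\mathbf{X}\in\{0,1\}^{n\times p}$ has i.i.d. Bernoulli$(\nu/k)$ entries, independent of $S$, where $X^{(i)}_j=1$ iff item $j$ is in test $i$. The outcomes are $\mathbf{Y}\in\{0,1\}^n$ with $Y^{(i)}=\bigvee_{j\in S}X^{(i)}_j$. A decoder outputs an estimate $\hat S\subseteq\{1,\dots,p\}$ based on $(\mathbf{X},\mathbf{Y})$ (and knowledge of $p,k$). Probabilities are over $S$ and $\mathbf{X}$ (and any randomness of the decoder). *)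

(* Defs.v *)
(* Mathematical Components + MathComp-Analysis, over an arbitrary realType. *)
From HB Require Import structures.
From mathcomp Require Import all_boot all_order all_algebra.
From mathcomp Require Import all_classical all_reals all_analysis.

Set Implicit Arguments.
Unset Strict Implicit.
Unset Printing Implicit Defensive.

Import Order.TTheory GRing.Theory Num.Theory.
Local Open Scope ring_scope.

Record fdist (R : realType) (T : finType) := FDist {
  pmf :> T -> R;
  pmf_ge0 : forall t, 0 <= pmf t;
  pmf_sum1 : \sum_t pmf t = 1 }.

Definition log2 (R : realType) (x : R) : R := ln x / ln 2.

(* The p items are the elements of 'I_p; X i j holds iff item j is in test i. *)
Definition outcomes (n p : nat) (X : 'M[bool]_(n, p)) (S : {set 'I_p}) :
  'cV[bool]_n := \col_i [exists j in S, X i j].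

(* Uniform law on the k-subsets of 'I_p (a probability only when k <= p). *)
Definition prior (R : realType) (p k : nat) (S : {set 'I_p}) : R :=
  if #|S| == k then ('C(p, k)%:R)^-1 else 0.

(* Law of a matrix with i.i.d. Bernoulli(q) entries. *)
Definition bernoulli_design (R : realType) (q : R) (n p : nat)
  (X : 'M[bool]_(n, p)) : R := \prod_(i < n) \prod_(j < p) bernoulli_pmf q (X i j).

(* A possibly randomized decoder: the law of the estimate given (X, Y). Its
   internal randomness is thus independent of S given (X, Y); deterministic
   decoders are the point masses. *)
Definition decoder (R : realType) (n p : nat) :=
  'M[bool]_(n, p) -> 'cV[bool]_n -> fdist R {set 'I_p}.

(* Joint law of (S, X, Shat). *)
Definition joint_pmf (R : realType) (n p k : nat) (q : R) (dec : decoder R n p)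
  (w : {set 'I_p} * 'M[bool]_(n, p) * {set 'I_p}) : R :=
  let: (s, X, shat) := w in
  prior R k s * bernoulli_design q X * dec X (outcomes X s) shat.

Definition prob (R : realType) (n p k : nat) (q : R) (dec : decoder R n p)
  (E : pred ({set 'I_p} * 'M[bool]_(n, p) * {set 'I_p})) : R :=
  \sum_(w | E w) joint_pmf k q dec w.

Definition approx_recovery (R : realType) (n p k : nat) (alpha : R) :
  pred ({set 'I_p} * 'M[bool]_(n, p) * {set 'I_p}) :=
  fun w => let: (s, X, shat) := w in
  (maxn #|shat :\: s| #|s :\: shat|)%:R <= alpha * k%:R.

(* Main.v *)
(* Compare with the null model in which Y is uniform and independent of X. Since
   (1 - nu/k)^k = 1/2, each k-set has the null law of Y as its marginal, and two
   k-sets s, s' produce the same n outcomes with probability 2^-n t^l, where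
   l = #|s :&: s'| and t = (1 - nu/k)^-n, so that t^k = 2^n.
   The success probability is the null expectation of L, the part of the
   likelihood ratio carried by the k-sets s close to the estimate H. Such sets
   satisfy #|s :&: H| >= (1 - alpha) k while #|H| <= 2 k, so Cauchy-Schwarz over
   the items of H shows that an average pair of them overlaps in a fixed
   fraction of k; this works for all alpha < 1, whereas two individual sets may
   be disjoint. Hence E[L^2] is at most a constant times E[l t^l], with l the
   overlap of two independent uniform k-sets, and
     E[l t^l] <= E[(2 t)^l] - 1 <= (1 + (2 t - 1) k / p)^k - 1
              <= exp(2 t k^2 / p) - 1.
   Finally t <= C(p, k)^((1 - eta) / k) <= (e p / k)^(1 - eta) gives
   t k^2 / p <= e (k / p^(eta / (1 + eta)))^(1 + eta), which tends to 0. *)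
Require Import Defs.
From HB Require Import structures.
From mathcomp Require Import all_boot all_order all_algebra.
From mathcomp Require Import all_classical all_reals all_analysis.
From mathcomp Require Import ring lra.

Set Implicit Arguments.
Unset Strict Implicit.
Unset Printing Implicit Defensive.

Import Order.TTheory GRing.Theory Num.Theory.
Import numFieldNormedType.Exports.
Local Open Scope ring_scope.

(** * Agreement of the outcomes of two sets under the Bernoulli design *)

Lemma sum_matrix_prod_rows (R : comPzRingType) (T : finType) (n p : nat)
    (F : {ffun 'I_p -> T} -> R) :
  \sum_(X : 'M[T]_(n, p)) \prod_i F [ffun j => X i j]
    = (\sum_x F x) ^+ n.
Proof.
rewrite -[n in RHS]card_ord -prodr_const bigA_distr_bigA /=.
pose h (f : {ffun 'I_n -> {ffun 'I_p -> T}}) := \matrix_(i, j) f i j.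
pose h' (X : 'M[T]_(n, p)) := [ffun i => [ffun j => X i j]].
rewrite (reindex h); last first.
  exists h' => [f | X] _; last by apply/matrixP => i j; rewrite !mxE !ffunE.
  by apply/ffunP => i; apply/ffunP => j; rewrite !ffunE mxE.
apply: eq_bigr => f _.
by apply: eq_bigr => i _; congr F; apply/ffunP => j; rewrite ffunE mxE.
Qed.

(** Both the law of a row and the event that it misses [A] factor over the items. The sum of
    products is therefore a product of sums, [1 - q] for an item of [A] and [1] for any other. *)
Lemma sum_bernoulli_avoid (R : realType) (q : R) (p : nat) (A : {set 'I_p}) :
  \sum_(x : {ffun 'I_p -> bool})
     (\prod_j bernoulli_pmf q (x j)) * (~~ [exists j in A, x j])%:R
    = (1 - q) ^+ #|A|.
Proof.
pose F (j : 'I_p) b := bernoulli_pmf q b * (if j \in A then (~~ b)%:R else 1).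
transitivity (\sum_(x : {ffun 'I_p -> bool}) \prod_j F j (x j)).
  apply: eq_bigr => x _; rewrite big_split /=; congr (_ * _).
  rewrite -big_mkcond /=; case: existsP => [[j /andP[jA xj]]|xA].
    by rewrite (bigD1 j) //= xj mul0r.
  rewrite big1 // => j jA; case: (boolP (x j)) => // xj.
  by case: xA; exists j; rewrite jA.
rewrite -bigA_distr_bigA -prodr_const [RHS]big_mkcond /=.
apply: eq_bigr => j _; rewrite big_bool /F /bernoulli_pmf /=.
by case: ifP => _; ring.
Qed.

(** If [u] and [v] indicate that a test misses [A] and [B], then agreement has indicator
    [1 - u - v + 2 u v], and [u v] indicates that the test misses the union. *)
Lemma sum_bernoulli_agree (R : realType) (q : R) (p : nat)
    (A B : {set 'I_p}) :
  \sum_(x : {ffun 'I_p -> bool}) (\prod_j bernoulli_pmf q (x j)) *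
     ([exists j in A, x j] == [exists j in B, x j])%:R
    = 1 - (1 - q) ^+ #|A| - (1 - q) ^+ #|B| + 2 * (1 - q) ^+ #|A :|: B|.
Proof.
rewrite -!sum_bernoulli_avoid -[X in X - _ - _ + _](expr0 (1 - q)).
have <- : \sum_(x : {ffun 'I_p -> bool}) (\prod_j bernoulli_pmf q (x j)) *
     (~~ [exists j in finset.set0, x j])%:R = (1 - q) ^+ 0.
  by rewrite sum_bernoulli_avoid cards0.
rewrite mulr_sumr -!sumrB -big_split /=; apply: eq_bigr => x _.
have -> : [exists j in A :|: B, x j]
    = [exists j in A, x j] || [exists j in B, x j].
  apply/existsP/orP => [[j]|].
    rewrite inE andb_orl => /orP[|] h; [left|right]; apply/existsP;
    by exists j.
  by case=> /existsP[j /andP[h hx]]; exists j; rewrite inE h ?orbT.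
have -> : [exists j in finset.set0, x j] = false.
  by apply/existsP => -[j]; rewrite inE.
by case: ([exists j in A, x j]); case: ([exists j in B, x j]) => /=; ring.
Qed.

(** The choice [(1 - q)^k = 1/2] cancels the constant and linear terms of the agreement probability
    of one test. As the union has [2 k - l] items, with [l] the overlap, [(1 - q)^(- l) / 2]
    remains; the [n] rows are independent. *)
Lemma sum_design_agree (R : realType) (q : R) (n p k : nat)
    (s s' : {set 'I_p}) : (1 - q) ^+ k = 2^-1 -> #|s| = k -> #|s'| = k ->
  2 ^+ n * \sum_(X : 'M[bool]_(n, p))
     bernoulli_design q X * (outcomes X s == outcomes X s')%:R
    = ((1 - q) ^- n) ^+ #|s :&: s'|.
Proof.
move=> qk ks ks'.
pose F (x : {ffun 'I_p -> bool}) := (\prod_j bernoulli_pmf q (x j)) *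
     ([exists j in s, x j] == [exists j in s', x j])%:R.
have -> : \sum_(X : 'M[bool]_(n, p))
     bernoulli_design q X * (outcomes X s == outcomes X s')%:R
   = \sum_(X : 'M[bool]_(n, p)) \prod_i F [ffun j => X i j].
  apply: eq_bigr => X _; rewrite big_split /=; congr (_ * _).
    by apply: eq_bigr => i _; apply: eq_bigr => j _; rewrite ffunE.
  have E i (A : {set 'I_p}) :
      [exists j in A, [ffun j => X i j] j] = outcomes X A i 0.
    by rewrite mxE; apply: eq_existsb => j; rewrite ffunE.
  under eq_bigr do rewrite !E.
  case: eqP => [->|neq]; first by rewrite big1 // => i _; rewrite eqxx.
  suff /existsP[i ne] : [exists i, outcomes X s i 0 != outcomes X s' i 0].
    by rewrite (bigD1 i) //= (negbTE ne) mul0r.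
  apply: contraT; rewrite negb_exists => /forallP eq; case: neq.
  by apply/colP => i; apply/eqP; move: (eq i); rewrite negbK.
rewrite sum_matrix_prod_rows /F sum_bernoulli_agree ks ks' qk.
(* A zero base would make [(1 - q)^k] equal to [0], or to [1] when [k = 0], and never [1/2]. *)
have q0 : 1 - q != 0.
  clear -qk; apply/eqP => q0; move: qk; rewrite q0 expr0n.
  by case: (k == 0%N) => /= ?; lra.
have -> : (1 - q) ^+ #|s :|: s'| = 4^-1 * (1 - q) ^- #|s :&: s'|.
  apply: (mulIf (expf_neq0 #|s :&: s'| q0)).
  by rewrite mulfVK ?expf_neq0 // -exprD cardsUI ks ks' exprD qk; field.
rewrite -exprMn [RHS]exprVn -exprM mulnC exprM -[RHS]exprVn; congr (_ ^+ _).
by field; rewrite expf_neq0.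
Qed.

(** * Generating function of the overlap with a uniform [k]-set *)

Lemma exprD1_card (R : comPzRingType) (T : finType) (A : {set T}) (u : R) :
  (1 + u) ^+ #|A| = \sum_(J : {set T} | J \subset A) u ^+ #|J|.
Proof.
pose F i := if i \in A then u else 0.
transitivity (\prod_i (F i + 1)).
  rewrite -prodr_const big_mkcond; apply: eq_bigr => i _.
  by rewrite /F; case: ifP => _; rewrite ?add0r // addrC.
transitivity (\sum_(J : {set T}) \prod_i (if i \in J then F i else 1)).
  exact: bigA_distr.
rewrite [RHS]big_mkcond; apply: eq_bigr => J _; rewrite -big_mkcond /=.
case: ifPn => [/fintype.subsetP JA|/subsetPn[i iJ iA]].
  by rewrite -prodr_const; apply: eq_bigr => i /JA iA; rewrite /F iA.
by rewrite (bigD1 i) //= /F (negbTE iA) mul0r.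
Qed.

(** Removing [J] is injective on the supersets of [J] and leaves a subset of the complement of [J]
    with [k - #|J|] elements. *)
Lemma card_superdraws (T : finType) (k : nat) (J : {set T}) : (#|J| <= k)%N ->
  (#|[set A : {set T} | (#|A| == k) && (J \subset A)]|
     <= 'C(#|T| - #|J|, k - #|J|))%N.
Proof.
move=> Jk; have -> : (#|T| - #|J| = #|~: J|)%N.
  by rewrite [in RHS]cardsCs finset.setCK.
set S := [set A | _]; rewrite -cards_draws.
have <- : #|[set A :\: J | A in S]| = #|S|.
  apply: card_in_imset => A B; rewrite !inE => /andP[_ JA] /andP[_ JB] eqAB.
  by rewrite -(finset.setID A J) -(finset.setID B J) eqAB
    (finset.setIidPr JA) (finset.setIidPr JB).
apply/subset_leq_card/fintype.subsetP => _ /imsetP[A + ->].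
rewrite !inE => /andP[/eqP Ak JA].
rewrite finset.setDE finset.subsetIr /= -finset.setDE cardsD.
by rewrite (finset.setIidPr JA) Ak.
Qed.

(** A uniform [k]-set contains [j] given items with probability at most [(k / p)^j]: each further
    item costs a factor [(k - j) / (p - j) <= k / p]. *)
Lemma bin_sub_le (R : realType) (p k j : nat) : (j <= k <= p)%N -> (0 < p)%N ->
  'C(p - j, k - j)%:R <= (k%:R / p%:R) ^+ j * 'C(p, k)%:R :> R.
Proof.
move=> /andP[+ kp] p0; elim: j => [|j IH] jk.
  by rewrite expr0 mul1r !subn0.
have {IH} := IH (ltnW jk).
have := mul_bin_diag (p - j) (k - j.+1).
rewrite -subnS -subSn // subSS => /(congr1 (fun x => x%:R : R)).
rewrite !natrM => E IH.
have pj : (0 : R) < (p - j)%:R by rewrite ltr0n subn_gt0 (leq_trans jk).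
have -> : 'C(p - j.+1, k - j.+1)%:R
    = (k - j)%:R / (p - j)%:R * 'C(p - j, k - j)%:R :> R.
  by rewrite mulrAC -E mulrAC mulfV ?mul1r // gt_eqF.
rewrite exprS -[leRHS]mulrA; apply: ler_pM => //.
rewrite ler_pdivrMr // mulrAC ler_pdivlMr ?ltr0n // -!natrM ler_nat.
by rewrite mulnBr mulnBl leq_sub2l // mulnC leq_mul2l kp orbT.
Qed.

(** Writing [t = 1 + (t - 1)] expands [t^l] over the sets [J] contained in both [s] and [s'], with
    nonnegative coefficients. Bounding the chance of [J \subset s'] by [(k / p)^#|J|] and refolding
    gives the value for independent memberships of probability [k / p]. *)
Lemma prior_overlap_mgf (R : realType) (p k : nat) (t : R) (s : {set 'I_p}) :
  (k <= p)%N -> (0 < p)%N -> 1 <= t -> #|s| = k ->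
  \sum_s' prior R k s' * t ^+ #|s :&: s'| <= (1 + (t - 1) * (k%:R / p%:R)) ^+ k.
Proof.
move=> kp p0 t1 ks.
rewrite -[in leRHS]ks exprD1_card.
have expand s' : prior R k s' * t ^+ #|s :&: s'|
    = \sum_(J : {set 'I_p}) (if J \subset s then
        if J \subset s' then prior R k s' * (t - 1) ^+ #|J| else 0 else 0).
  rewrite -[t in LHS](subrKC 1) exprD1_card mulr_sumr big_mkcond /=.
  by apply: eq_bigr => J _; rewrite finset.subsetI if_and.
under eq_bigr do rewrite expand.
rewrite exchange_big /= [leRHS]big_mkcond; apply: ler_sum => J _.
case: ifPn => [Js|_]; last by rewrite big1.
have Jk : (#|J| <= k)%N by rewrite -ks subset_leq_card.
have C0 : (0 : R) < 'C(p, k)%:R by rewrite ltr0n bin_gt0.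
have -> : \sum_(s' : {set 'I_p})
      (if J \subset s' then prior R k s' * (t - 1) ^+ #|J| else 0)
    = #|[set A : {set 'I_p} | (#|A| == k) && (J \subset A)]|%:R
      / 'C(p, k)%:R * (t - 1) ^+ #|J|.
  rewrite -sumr_const mulr_suml mulr_suml [RHS]big_mkcond /=.
  apply: eq_bigr => A _; rewrite inE /prior.
  by case: (J \subset A); case: eqP; rewrite /= ?mul0r ?mul1r.
rewrite exprMn mulrC ler_wpM2l ?exprn_ge0 ?subr_ge0 //.
rewrite ks ler_pdivrMr //.
apply: le_trans (bin_sub_le _ _ p0); last by rewrite Jk.
rewrite ler_nat; have := card_superdraws Jk; by rewrite card_ord.
Qed.

(** * Normalization and positivity of the two laws *)

Lemma sum_prior (R : realType) (p k : nat) : (k <= p)%N ->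
  \sum_s prior R (p := p) k s = 1.
Proof.
move=> kp; rewrite /prior -big_mkcond sumr_const -cardsE card_draws card_ord.
by rewrite -[LHS]mulr_natl mulfV // pnatr_eq0 -lt0n bin_gt0.
Qed.

Lemma prior_ge0 (R : realType) (p k : nat) (s : {set 'I_p}) : 0 <= prior R k s.
Proof. by rewrite /prior; case: ifP => // _; rewrite invr_ge0. Qed.

Lemma bernoulli_design_ge0 (R : realType) (q : R) (n p : nat)
  (X : 'M[bool]_(n, p)) : 0 <= q <= 1 -> 0 <= bernoulli_design q X.
Proof.
by move=> q01; do 2!apply: prodr_ge0 => ? _; apply: bernoulli_pmf_ge0.
Qed.

Lemma sum_bernoulli_design (R : realType) (q : R) (n p : nat) :
  \sum_(X : 'M[bool]_(n, p)) bernoulli_design q X = 1.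
Proof.
(* Missing the empty set is certain, so each row has total mass [1]. *)
have := sum_bernoulli_avoid q (finset.set0 : {set 'I_p}).
rewrite cards0 expr0 => S1.
pose F (x : {ffun 'I_p -> bool}) := (\prod_j bernoulli_pmf q (x j)) *
     (~~ [exists j in (finset.set0 : {set 'I_p}), x j])%:R.
rewrite -[RHS](expr1n _ n) -S1 -(sum_matrix_prod_rows n F).
apply: eq_bigr => X _; apply: eq_bigr => i _; rewrite /F.
case: existsP => [[j]|_]; first by rewrite inE.
by rewrite mulr1; apply: eq_bigr => j _; rewrite ffunE.
Qed.

(** * Second-moment bound on the success probability *)

Lemma natr_card_setI (R : pzSemiRingType) (T : finType) (A B : {set T}) :
  #|A :&: B|%:R = \sum_(j in A) (j \in B)%:R :> R.
Proof.
rewrite -sumr_const big_mkcond [RHS]big_mkcond; apply: eq_bigr => j _.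
by rewrite inE; case: (j \in A); case: (j \in B).
Qed.

(** Let [m j] be the mass of the sets in [B] that contain [j]. Over [H] these add up to at least [a]
    times the mass of [B], while the sum of their squares counts pairs of sets by their shared items
    in [H]. Cauchy-Schwarz over at most [b] items links the two. *)
Lemma overlap_lower_bound (R : realFieldType) (T : finType)
    (mu : {set T} -> R) (H : {set T}) (B : pred {set T}) (a b : R) :
  (forall s, 0 <= mu s) -> 0 <= a -> 0 < b ->
  (forall s, B s -> a <= #|H :&: s|%:R /\ #|H|%:R <= b) ->
  (a * \sum_(s | B s) mu s) ^+ 2
    <= b * \sum_s \sum_s' mu s * mu s' * #|s :&: s'|%:R.
Proof.
move=> mu0 a0 b0 HB.
have M0 : 0 <= \sum_s \sum_s' mu s * mu s' * #|s :&: s'|%:R.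
  by do 2!apply: sumr_ge0 => ? _; rewrite !mulr_ge0.
(* The bound on [#|H|] is available only through a member of [B]; if there is none, the left side
   vanishes. *)
have [s0 Bs0|nB] := pickP B; last first.
  by rewrite big_pred0 // mulr0 expr0n mulr_ge0 // ltW.
have {s0 Bs0} [_ Hb] := HB _ Bs0.
pose w s := if B s then mu s else 0.
have w0 s : 0 <= w s by rewrite /w; case: ifP.
have wmu s : w s <= mu s by rewrite /w; case: ifP.
pose m j := \sum_s w s * (j \in s)%:R.
have le1 : a * \sum_(s | B s) mu s <= \sum_(j in H) m j.
  rewrite exchange_big /= big_mkcond mulr_sumr; apply: ler_sum => s _.
  rewrite -mulr_sumr -natr_card_setI mulrC /w.
  by case: ifPn => [/HB[h _]|]; rewrite ?mul0r // ler_wpM2l.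
(* Cauchy-Schwarz, by expanding the sum of (m j - x / b)^2. *)
have le2 : (\sum_(j in H) m j) ^+ 2 <= b * \sum_(j in H) m j ^+ 2.
  set x := \sum_(j in H) m j.
  have : 0 <= \sum_(j in H) (m j - x / b) ^+ 2.
    by apply: sumr_ge0 => j _; rewrite sqr_ge0.
  under eq_bigr do rewrite sqrrB.
  rewrite big_split sumrB /= sumr_const sumrMnl -mulr_suml -/x.
  rewrite -[_ *+ #|_|]mulr_natl.
  set Q := \sum_(j in H) _ => h.
  have {}h : 0 <= Q - (x * (x / b)) *+ 2 + b * (x / b) ^+ 2.
    by apply: le_trans h _; rewrite lerD2l ler_wpM2r // sqr_ge0.
  have := mulr_ge0 (ltW b0) h.
  have -> : b * (Q - (x * (x / b)) *+ 2 + b * (x / b) ^+ 2) = b * Q - x ^+ 2.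
    by field; rewrite gt_eqF.
  by rewrite subr_ge0.
(* Dropping the restrictions to [B] and to items of [H] only adds nonnegative terms. *)
have le3 : \sum_(j in H) m j ^+ 2
    <= \sum_s \sum_s' mu s * mu s' * #|s :&: s'|%:R.
  apply: (@le_trans _ _ (\sum_(j in H) \sum_s \sum_s'
     mu s * mu s' * ((j \in s)%:R * (j \in s')%:R))).
    apply: ler_sum => j _; rewrite expr2 /m big_distrlr /=.
    apply: ler_sum => s _; apply: ler_sum => s' _; rewrite mulrACA.
    by rewrite ler_wpM2r ?mulr_ge0 // ler_pM.
  rewrite exchange_big; apply: ler_sum => s _ /=.
  rewrite exchange_big; apply: ler_sum => s' _ /=.
  rewrite -mulr_sumr ler_wpM2l ?mulr_ge0 // natr_card_setI big_mkcond /=.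
  rewrite [leRHS]big_mkcond; apply: ler_sum => j _.
  case: (j \in H); case: (j \in s); case: (j \in s');
  by rewrite /= ?mul1r ?mul0r.
apply: le_trans (_ : _ <= (\sum_(j in H) m j) ^+ 2) _.
  by rewrite lerXn2r // nnegrE ?mulr_ge0 ?sumr_ge0 // => j _;
     rewrite sumr_ge0 // => s _; rewrite mulr_ge0.
by apply: le_trans le2 _; rewrite ler_pM2l.
Qed.

(* The summand of the likelihood ratio of (X, Y) against the null model in which
   Y is uniform and independent of X. *)
Definition evidence (R : realType) (n p k : nat) (X : 'M[bool]_(n, p))
    (Y : 'cV[bool]_n) (s : {set 'I_p}) : R :=
  2 ^+ n * (prior R k s * (outcomes X s == Y)%:R).

Lemma evidence_ge0 (R : realType) (n p k : nat) (X : 'M[bool]_(n, p))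
  (Y : 'cV[bool]_n) (s : {set 'I_p}) : 0 <= evidence R k X Y s.
Proof. by rewrite mulr_ge0 ?exprn_ge0 // mulr_ge0 ?prior_ge0. Qed.

(** This is the change of measure to the null model: [Y] becomes a free uniform variable, and the
    factor [2^n] in [evidence] offsets its weight. The estimate is then drawn before the sum over
    [s]. *)
Lemma prob_evidenceE (R : realType) (n p k : nat) (q : R) (dec : decoder R n p)
    (E : pred ({set 'I_p} * 'M[bool]_(n, p) * {set 'I_p})) :
  prob k q dec E = \sum_X bernoulli_design q X * \sum_Y 2^-1 ^+ n *
    \sum_shat dec X Y shat *
      \sum_(s : {set 'I_p} | (#|s| == k) && E (s, X, shat)) evidence R k X Y s.
Proof.
have -> : prob k q dec E = \sum_s \sum_X \sum_shat
    (if E (s, X, shat) then joint_pmf k q dec (s, X, shat) else 0).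
  rewrite /prob big_mkcond /= pair_bigA /= pair_bigA /=.
  by apply: eq_bigr => -[[s X] shat].
rewrite exchange_big /=; apply: eq_bigr => X _.
(* Introduces [Y] as a summation variable tied to the true outcomes by an indicator. *)
have pick s (f : 'cV[bool]_n -> R) :
    f (outcomes X s) = \sum_Y (outcomes X s == Y)%:R * f Y.
  rewrite (bigD1 (outcomes X s)) //= eqxx mul1r big1 ?addr0 // => Y.
  by rewrite eq_sym => /negbTE ->; rewrite mul0r.
pose F s shat Y : R := (outcomes X s == Y)%:R *
  (if E (s, X, shat) then prior R k s * bernoulli_design q X * dec X Y shat
   else 0).
transitivity (\sum_Y \sum_shat \sum_s F s shat Y).
  transitivity (\sum_Y \sum_s \sum_shat F s shat Y); last first.
    by apply: eq_bigr => Y _; rewrite exchange_big.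
  rewrite [RHS]exchange_big; apply: eq_bigr => s _.
  rewrite [RHS]exchange_big; apply: eq_bigr => shat _.
  rewrite /F -(pick s (fun Y => if E (s, X, shat) then _ else 0)).
  by case: ifP.
rewrite mulr_sumr; apply: eq_bigr => Y _; rewrite mulrA mulr_sumr.
apply: eq_bigr => shat _; rewrite !mulr_sumr [RHS]big_mkcond.
apply: eq_bigr => s _; rewrite /F /evidence /prior.
have e2 : (2^-1 : R) ^+ n * 2 ^+ n = 1 by rewrite -exprMn mulVf // expr1n.
case: (#|s| == k) => /=; case: ifP => _; rewrite ?mul0r ?mulr0 //.
by rewrite -[LHS]mul1r -[X in X * _ = _]e2; ring.
Qed.

Lemma sum_uniform_outcomes (R : realType) (n : nat) :
  \sum_(Y : 'cV[bool]_n) (2^-1 : R) ^+ n = 1.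
Proof.
rewrite sumr_const card_mx card_bool muln1 -[LHS]mulr_natl natrX.
by rewrite -exprMn mulfV // expr1n.
Qed.

(** The missed items bound the overlap from below; [#|H|] is the overlap, at most [k], plus at most
    [alpha k] false positives. *)
Lemma approx_recovery_overlap (R : realType) (n p k : nat) (alpha : R)
    (X : 'M[bool]_(n, p)) (s H : {set 'I_p}) : alpha < 1 -> #|s| = k ->
  approx_recovery k alpha (s, X, H) ->
  (1 - alpha) * k%:R <= #|H :&: s|%:R /\ #|H|%:R <= 2 * k%:R :> R.
Proof.
move=> a1 ks; rewrite /approx_recovery => h.
have hH : #|H :\: s|%:R <= alpha * k%:R :> R.
  by apply: le_trans h; rewrite ler_nat leq_maxl.
have hs : #|s :\: H|%:R <= alpha * k%:R :> R.
  by apply: le_trans h; rewrite ler_nat leq_maxr.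
have Es : k%:R = #|H :&: s|%:R + #|s :\: H|%:R :> R.
  by rewrite -ks -natrD finset.setIC cardsID.
have EH : #|H|%:R = #|H :&: s|%:R + #|H :\: s|%:R :> R.
  by rewrite -natrD cardsID.
have k0 : 0 <= k%:R :> R by [].
have ak : alpha * k%:R <= k%:R by rewrite ler_piMl // ltW.
have : 0 <= #|s :\: H|%:R :> R by [].
rewrite EH mulrBl mul1r {1}Es => ?.
by split; lra.
Qed.

(** Only the [Y] equal to both outcomes contributes. One factor [2^n] cancels the null weight and
    the other normalizes the agreement probability. *)
Lemma evidence_pair (R : realType) (q : R) (n p k : nat) (s s' : {set 'I_p}) :
  (1 - q) ^+ k = 2^-1 ->
  \sum_(X : 'M[bool]_(n, p)) bernoulli_design q X * \sum_Y 2^-1 ^+ n *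
    (evidence R k X Y s * evidence R k X Y s')
  = prior R k s * prior R k s' * ((1 - q) ^- n) ^+ #|s :&: s'|.
Proof.
move=> qk.
have [ks|nks] := eqVneq #|s| k; last first.
  rewrite /prior (negbTE nks) !mul0r big1 // => X _.
  rewrite big1 ?mulr0 // => Y _.
  by rewrite /evidence /prior (negbTE nks) !(mul0r, mulr0).
have [ks'|nks'] := eqVneq #|s'| k; last first.
  rewrite /prior (negbTE nks') mulr0 mul0r big1 // => X _.
  rewrite big1 ?mulr0 // => Y _.
  by rewrite /evidence /prior (negbTE nks') !(mul0r, mulr0).
rewrite -(sum_design_agree n qk ks ks') 2!mulr_sumr; apply: eq_bigr => X _.
rewrite (bigD1 (outcomes X s')) //= big1 ?addr0 => [|Y /negbTE YN]; last first.
  by rewrite /evidence eq_sym in YN *; rewrite YN !mulr0.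
have e2 : (2^-1 : R) ^+ n * 2 ^+ n = 1 by rewrite -exprMn mulVf // expr1n.
rewrite /evidence eqxx mulr1.
transitivity ((2^-1 ^+ n * 2 ^+ n) * (bernoulli_design q X * (2 ^+ n *
  (prior R k s * (outcomes X s == outcomes X s')%:R)) * prior R k s')).
  by ring.
by rewrite e2; ring.
Qed.

Lemma evidence_second_moment (R : realType) (q : R) (n p k : nat)
    (d : {set 'I_p} -> {set 'I_p} -> R) : (1 - q) ^+ k = 2^-1 ->
  \sum_(X : 'M[bool]_(n, p)) bernoulli_design q X * \sum_Y 2^-1 ^+ n *
    \sum_s \sum_s' evidence R k X Y s * evidence R k X Y s' * d s s'
  = \sum_s \sum_s' prior R k s * prior R k s' *
      ((1 - q) ^- n) ^+ #|s :&: s'| * d s s'.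
Proof.
move=> qk.
transitivity (\sum_s \sum_s' (\sum_(X : 'M[bool]_(n, p)) bernoulli_design q X *
    \sum_Y 2^-1 ^+ n * (evidence R k X Y s * evidence R k X Y s')) * d s s');
  last first.
  by do 2!apply: eq_bigr => ? _; rewrite evidence_pair.
under [RHS]eq_bigr do under eq_bigr do rewrite mulr_suml.
under [RHS]eq_bigr do rewrite exchange_big.
rewrite [RHS]exchange_big /=; apply: eq_bigr => X _.
under [RHS]eq_bigr do under eq_bigr do rewrite -mulrA mulr_suml.
under [RHS]eq_bigr do rewrite -mulr_sumr exchange_big.
rewrite -[RHS]mulr_sumr; congr (_ * _).
rewrite [RHS]exchange_big /=; apply: eq_bigr => Y _.
rewrite mulr_sumr; apply: eq_bigr => s _; rewrite mulr_sumr.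
by apply: eq_bigr => s' _; rewrite !mulrA.
Qed.

Lemma one_sub_gt0 (R : numFieldType) (q : R) (k : nat) : (0 < k)%N ->
  q <= 1 -> (1 - q) ^+ k = 2^-1 -> 0 < 1 - q.
Proof.
move=> k0 q1 qk; rewrite lt_neqAle subr_ge0 q1 andbT eq_sym; apply/eqP => q0.
move: qk; rewrite q0 expr0n eqn0Ngt k0 => /eqP.
by rewrite eq_sym invr_eq0 pnatr_eq0.
Qed.

(** The threshold [d] is free: [L <= d + L^2 / d] trades the mean of [L] for its second moment. The
    final [- 1] appears because disjoint pairs have overlap weight zero. *)
Lemma prob_approx_recovery_le (R : realType) (n p k : nat) (q alpha d : R)
    (dec : decoder R n p) :
  (0 < k <= p)%N -> 0 <= q <= 1 -> (1 - q) ^+ k = 2^-1 -> alpha < 1 -> 0 < d ->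
  prob k q dec (approx_recovery k alpha) <= d + 2 / ((1 - alpha) ^+ 2 * d) *
    ((1 + (2 * (1 - q) ^- n - 1) * (k%:R / p%:R)) ^+ k - 1).
Proof.
move=> /andP[k0 kp] q01 qk a1 d0.
have p0 : (0 < p)%N := leq_trans k0 kp.
have kR : (0 : R) < k%:R by rewrite ltr0n.
have kR1 : (1 : R) <= k%:R by rewrite ler1n.
have a1' : 0 < 1 - alpha by rewrite subr_gt0.
set t := (1 - q) ^- n.
have q0 : 0 < 1 - q := one_sub_gt0 k0 (andP q01).2 qk.
have t1 : 1 <= t.
  rewrite /t invf_ge1 ?exprn_gt0 //; apply: exprn_ile1; first exact: ltW.
  by rewrite gerBl; case/andP: q01.
pose M X Y : R := \sum_s \sum_s' evidence R (n := n) (p := p) k X Y s *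
   evidence R k X Y s' * #|s :&: s'|%:R.
(* Solving [((1 - alpha) k L)^2 <= 2 k M] for [L^2 / d] produces this constant. *)
pose K := 2 / ((1 - alpha) ^+ 2 * k%:R * d).
have K0 : 0 < K by rewrite divr_gt0 // !mulr_gt0.
apply: (@le_trans _ _ (\sum_X bernoulli_design q X *
    \sum_Y 2^-1 ^+ n * (d + K * M X Y))).
  rewrite prob_evidenceE; apply: ler_sum => X _.
  rewrite ler_wpM2l ?bernoulli_design_ge0 //; apply: ler_sum => Y _.
  rewrite ler_wpM2l ?exprn_ge0 ?invr_ge0 //.
  (* The estimate has total mass [1] given [X] and [Y], so a bound for each fixed [H] also covers
     randomized decoders. *)
  rewrite -[leRHS]mul1r -(Defs.pmf_sum1 (dec X Y)) mulr_suml.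
  apply: ler_sum => H _; apply: ler_wpM2l; first exact: Defs.pmf_ge0.
  set L := (X in X <= _).
  have : ((1 - alpha) * k%:R * L) ^+ 2 <= 2 * k%:R * M X Y.
    apply: (@overlap_lower_bound _ _ (evidence R k X Y) H
      (fun s => (#|s| == k) && approx_recovery k alpha (s, X, H))).
    - exact: evidence_ge0.
    - by rewrite mulr_ge0 // ltW.
    - by rewrite mulr_gt0.
    - by move=> s /andP[/eqP ks]; exact: approx_recovery_overlap.
  move=> hL.
  have : L ^+ 2 / d <= K * M X Y.
    rewrite -(ler_pM2l (x := ((1 - alpha) * k%:R) ^+ 2 * d)); last first.
      by rewrite !mulr_gt0 // exprn_gt0 // mulr_gt0.
    have -> : ((1 - alpha) * k%:R) ^+ 2 * d * (L ^+ 2 / d)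
        = ((1 - alpha) * k%:R * L) ^+ 2 by field; rewrite gt_eqF.
    have -> : ((1 - alpha) * k%:R) ^+ 2 * d * (K * M X Y) = 2 * k%:R * M X Y.
      by rewrite /K; field; rewrite !gt_eqF.
    by [].
  move=> hLd; apply: (@le_trans _ _ (d + L ^+ 2 / d)); last by rewrite lerD2l.
  rewrite -lerBlDl ler_pdivlMr // -subr_ge0.
  have -> : L ^+ 2 - (L - d) * d = (L - d / 2) ^+ 2 + 3 / 4 * d ^+ 2 by field.
  by rewrite addr_ge0 ?sqr_ge0 // mulr_ge0 ?sqr_ge0.
have -> : \sum_(X : 'M[bool]_(n, p)) bernoulli_design q X *
      \sum_Y 2^-1 ^+ n * (d + K * M X Y)
    = d + K * \sum_(s : {set 'I_p}) \sum_s' prior R k s * prior R k s' *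
      t ^+ #|s :&: s'| * #|s :&: s'|%:R.
  rewrite -(evidence_second_moment n (fun s s' => #|s :&: s'|%:R) qk) -/M.
  have dX : \sum_(X : 'M[bool]_(n, p)) bernoulli_design q X * d = d.
    by rewrite -mulr_suml sum_bernoulli_design mul1r.
  have dY : \sum_(Y : 'cV[bool]_n) 2^-1 ^+ n * d = d.
    by rewrite -mulr_suml sum_uniform_outcomes mul1r.
  rewrite -[X in _ = X + _]dX mulr_sumr -big_split; apply: eq_bigr => X _ /=.
  rewrite mulrCA -mulrDr; congr (_ * _).
  rewrite -[X in _ = X + _]dY mulr_sumr -big_split.
  by apply: eq_bigr => Y _ /=; rewrite mulrDr [K * (_ * _)]mulrCA.
rewrite lerD2l.
set G := _ ^+ k - 1.
have : \sum_(s : {set 'I_p}) \sum_s' prior R k s * prior R k s' *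
      t ^+ #|s :&: s'| * #|s :&: s'|%:R <= G.
  rewrite -[G]mul1r -[X in X * G](sum_prior R kp) mulr_suml.
  apply: ler_sum => s _.
  under eq_bigr do rewrite -2!mulrA; rewrite -mulr_sumr.
  have [ks|nks] := eqVneq #|s| k; last by rewrite /prior (negbTE nks) !mul0r.
  rewrite ler_wpM2l ?prior_ge0 //.
  have t21 : 1 <= 2 * t by lra.
  rewrite lerBrDr; apply: le_trans (prior_overlap_mgf kp p0 t21 ks).
  rewrite -[X in _ + X](sum_prior R kp) -big_split; apply: ler_sum => s' _ /=.
  rewrite -[X in _ + X]mulr1 -mulrDr ler_wpM2l ?prior_ge0 //.
  (* [l t^l + 1 <= (2 t)^l], which replaces the factor [l] by a larger base. *)
  set l := #|s :&: s'|; rewrite exprMn -natrX.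
  have tl1 : 1 <= t ^+ l by rewrite exprn_ege1.
  have : (l%:R + 1 <= (2 ^ l)%:R :> R) by rewrite natr1 ler_nat ltn_expl.
  by move: tl1; move: (t ^+ l) (l%:R) => /= u v; nra.
move=> hG; apply: (@le_trans _ _ (K * G)); first by rewrite ler_pM2l.
have G0 : 0 <= G.
  apply: le_trans hG; do 2!apply: sumr_ge0 => ? _.
  rewrite mulr_ge0 // mulr_ge0 ?exprn_ge0 ?mulr_ge0 ?prior_ge0 //.
  exact: le_trans t1.
(* The factor [1 / k] in [K] is given up, as [1 <= k]. *)
rewrite ler_wpM2r // /K ler_pM2l // lef_pV2 ?posrE ?mulr_gt0 //.
by rewrite ler_pM2r // ler_peMr // sqr_ge0.
Qed.

Lemma prob_ge0 (R : realType) (n p k : nat) (q : R) (dec : decoder R n p) E :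
  0 <= q <= 1 -> 0 <= prob k q dec E.
Proof.
move=> q01; apply: sumr_ge0 => -[[s X] shat] _ /=.
rewrite mulr_ge0 ?mulr_ge0 ?prior_ge0 ?bernoulli_design_ge0 //.
exact: Defs.pmf_ge0.
Qed.

(** * Size of the binomial coefficient and of the exponent *)

Lemma bin_expn_le (R : numDomainType) (p k : nat) (x : R) : (k <= p)%N ->
  0 <= x -> 'C(p, k)%:R * x ^+ k <= (1 + x) ^+ p.
Proof.
move=> kp x0; have kp1 : (k < p.+1)%N by [].
rewrite exprDn (bigD1 (Ordinal kp1)) //= expr1n mul1r mulr_natl lerDl.
by apply: sumr_ge0 => i _; rewrite mulrn_wge0 // mulr_ge0 ?exprn_ge0.
Qed.

(** This is [C(p, k) <= (e p / k)^k]: take [x = k / p] in [bin_expn_le] and use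
    [1 + x <= expR x]. *)
Lemma ln_bin_le (R : realType) (p k : nat) : (0 < k <= p)%N ->
  ln 'C(p, k)%:R <= k%:R * (1 + ln p%:R - ln k%:R) :> R.
Proof.
move=> /andP[k0 kp]; have p0 := leq_trans k0 kp.
have kR : (0 : R) < k%:R by rewrite ltr0n.
have pR : (0 : R) < p%:R by rewrite ltr0n.
have x0 : (0 : R) < k%:R / p%:R by rewrite divr_gt0.
have C0 : (0 : R) < 'C(p, k)%:R by rewrite ltr0n bin_gt0.
have h : 'C(p, k)%:R * (k%:R / p%:R) ^+ k <= expR k%:R :> R.
  apply: le_trans (bin_expn_le kp (ltW x0)) _.
  rewrite -[X in expR X](divfK (lt0r_neq0 pR)) expRM_natr.
  by rewrite lerXn2r ?nnegrE ?expR_ge0 ?expR_ge1Dx //.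
move: h; rewrite -ler_ln ?posrE ?expR_gt0 ?mulr_gt0 ?exprn_gt0 //.
rewrite expRK lnM ?posrE ?exprn_gt0 // lnXn // ln_div ?posrE // -mulr_natl.
by lra.
Qed.

Lemma overlap_exponent_le (R : realType) (eta eps q : R) (k n p : nat) :
  0 < eta < 1 -> 0 < eps <= 1 -> (0 < k <= p)%N ->
  k%:R <= eps * p%:R `^ (eta / (1 + eta)) ->
  0 < 1 - q -> (1 - q) ^+ k = 2^-1 ->
  n%:R <= (1 - eta) * log2 ('C(p, k)%:R : R) ->
  (1 - q) ^- n * (k%:R ^+ 2 / p%:R) <= expR 1 * eps.
Proof.
move=> /andP[eta0 eta1] /andP[eps0 eps1] kp hk q0 qk hn.
have [k0 kp'] := andP kp.
have p0 := leq_trans k0 kp'.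
have kR : (0 : R) < k%:R by rewrite ltr0n.
have pR : (0 : R) < p%:R by rewrite ltr0n.
have two0 : (0 : R) < ln 2 by rewrite ln_gt0 // ltr1n.
have hK : ln k%:R <= ln eps + eta / (1 + eta) * ln p%:R.
  rewrite -ln_powR -lnM ?posrE ?powR_gt0 //.
  by rewrite ler_ln ?posrE ?mulr_gt0 ?powR_gt0.
have hq : ln (1 - q) *+ k = - ln 2 by rewrite -lnXn // qk lnV ?posrE.
have e0 : ln eps <= 0 by rewrite ln_le0.
have hC := ln_bin_le R kp.
rewrite /log2 mulrA ler_pdivlMr // in hn.
rewrite -ler_ln ?posrE ?mulr_gt0 ?invr_gt0 ?exprn_gt0 ?expR_gt0 //.
rewrite !lnM ?posrE ?mulr_gt0 ?invr_gt0 ?exprn_gt0 ?expR_gt0 //.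
rewrite !lnV ?posrE ?exprn_gt0 // !lnXn // expRK.
move: hn hC e0 hq hK.
rewrite -![ln _ *+ _]mulr_natr.
(* With the logarithms generalized to variables, only real arithmetic is left; [y], [e], [P], [K]
   stand for the logarithms of [1 - q], [eps], [p], [k]. *)
move: (ln (1 - q)) (ln eps) (ln p%:R) (ln k%:R) (ln 2) two0 (ln 'C(p, k)%:R).
move=> y e P K two two0 C hn hC e0 hq hK.
have hny : - y * n%:R <= (1 - eta) * (1 + P - K).
  rewrite -(ler_pM2r kR).
  apply: (@le_trans _ _ ((1 - eta) * C)); first by nra.
  by rewrite -mulrA ler_pM2l ?subr_gt0 // mulrC.
have e1 : 0 < 1 + eta by lra.
have hK' : (1 + eta) * K <= (1 + eta) * e + eta * P.
  have -> : (1 + eta) * e + eta * P = (1 + eta) * (e + eta / (1 + eta) * P).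
    by field; rewrite gt_eqF.
  by rewrite ler_pM2l.
(* Adding [2 K - P] to [hny] gives [(1 - eta) + (1 + eta) K - eta P], which is at most [1 + e] by
   [hK'] and [e <= 0]. *)
by nra.
Qed.

(** * Passage to the limit *)

Local Open Scope classical_set_scope.
Local Open Scope ring_scope.

Theorem theorem6 (R : realType) (eta : R) (heta : 0 < eta < 1)
  (k n : nat -> nat) (nu : nat -> R)
  (hnu01 : \forall p \near \oo, 0 <= nu p / (k p)%:R <= 1)
  (hnu : \forall p \near \oo, (1 - nu p / (k p)%:R) ^+ k p = 2^-1)
  (hn : \forall p \near \oo, (n p)%:R <= (1 - eta) * log2 ('C(p, k p)%:R : R))
  (hk : k p @[p --> \oo] --> \oo)
  (hko : (fun p : nat => (k p)%:R : R) =o_\oo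
         (fun p : nat => (p%:R : R) `^ (eta / (1 + eta))))
  (alpha : R) (halpha : 0 < alpha < 1)
  (dec : forall p : nat, decoder R (n p) p) :
  prob (k p) (nu p / (k p)%:R) (dec p) (approx_recovery (k p) alpha)
    @[p --> \oo] --> (0 : R).
Proof.
have [eta0 eta1] := andP heta.
have [alpha0 alpha1] := andP halpha.
apply/cvgr0Pnorm_le => e e0.
have a0 : 0 < 1 - alpha by rewrite subr_gt0.
pose d := e / 2; have d0 : 0 < d by rewrite divr_gt0.
(* Chosen so that the prefactor [2 / ((1 - alpha)^2 d)] times [tau] is [d], the second half of
   [e]. *)
pose tau := (1 - alpha) ^+ 2 * d / 2 * d.
have tau0 : 0 < tau by rewrite !mulr_gt0 // ?exprn_gt0 // invr_gt0.
(* The second entry ensures [expR (2 * expR 1 * eps) <= 1 + tau]; the cap at [1] gives [k <= p] and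
   [ln eps <= 0]. *)
pose eps : R := Num.min 1 (ln (1 + tau) / (2 * expR 1)).
have ln0 : 0 < ln (1 + tau) by rewrite ln_gt0 // ltrDl.
have eps0 : 0 < eps.
  by rewrite lt_min ltr01 divr_gt0 // mulr_gt0 ?expR_gt0.
have eps1 : eps <= 1 by rewrite ge_min lexx.
have hko' : \forall p \near \oo, `|(k p)%:R : R| <=
    eps * `|(p%:R : R) `^ (eta / (1 + eta))|.
  by move/eqoP: hko; apply.
have hk1 : \forall p \near \oo, (1 <= k p)%N by move/cvgnyPge: hk; apply.
near=> p.
have q01 : 0 <= nu p / (k p)%:R <= 1 by near: p.
have qk : (1 - nu p / (k p)%:R) ^+ k p = 2^-1 by near: p.
have hnp : (n p)%:R <= (1 - eta) * log2 ('C(p, k p)%:R : R) by near: p.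
have k0 : (0 < k p)%N by near: p.
have p0 : (0 < p)%N by near: p; exact: nbhs_infty_gt.
have hkp : (k p)%:R <= eps * (p%:R : R) `^ (eta / (1 + eta)).
  rewrite -[leLHS]ger0_norm // -[X in _ * X]ger0_norm ?powR_ge0 //.
  by near: p.
have kp : (k p <= p)%N.
  rewrite -(ler_nat R); apply: le_trans hkp _.
  rewrite -[leRHS]mul1r ler_pM ?powR_ge0 // ?(ltW eps0) //.
  rewrite -[leRHS]powRr1 // ler_powR ?ler1n //.
  by rewrite ler_pdivrMr ?mul1r; lra.
move: q01 qk; set q := nu p / _ => q01 qk.
have q1 : 0 < 1 - q := one_sub_gt0 k0 (andP q01).2 qk.
have kk : (0 < k p <= p)%N by rewrite k0.
have ee : 0 < eps <= 1 by rewrite eps0.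
have main := overlap_exponent_le heta ee kk hkp q1 qk hnp.
rewrite ger0_norm ?prob_ge0 //.
apply: le_trans (prob_approx_recovery_le (dec p) kk q01 qk alpha1 d0) _.
have -> : e = d + d by rewrite /d; field.
rewrite lerD2l.
have dE : d = 2 / ((1 - alpha) ^+ 2 * d) * tau.
  by rewrite /tau; field; rewrite !gt_eqF.
rewrite [leRHS]dE.
rewrite ler_pM2l; last by rewrite divr_gt0 // mulr_gt0 // exprn_gt0.
rewrite lerBlDl.
set t := (1 - q) ^- n p.
have t0 : 0 < t by rewrite invr_gt0 exprn_gt0.
have kR : (0 : R) < (k p)%:R by rewrite ltr0n.
have pR : (0 : R) < p%:R by rewrite ltr0n.
have x0 : 0 < (k p)%:R / p%:R :> R by rewrite divr_gt0.
have x1 : (k p)%:R / p%:R <= 1 :> R by rewrite ler_pdivrMr // mul1r ler_nat.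
set x := (k p)%:R / p%:R in x0 x1 *.
apply: (@le_trans _ _ (expR (2 * t * x) ^+ k p)).
  (* The base is nonnegative because [x <= 1] and [t > 0]. *)
  rewrite lerXn2r ?nnegrE ?expR_ge0 //; first by nra.
  by apply: le_trans (expR_ge1Dx _); nra.
rewrite -expRM_natr -[leRHS]lnK ?posrE; last by rewrite addr_gt0.
rewrite ler_expR.
have -> : 2 * t * x * (k p)%:R = 2 * (t * ((k p)%:R ^+ 2 / p%:R)).
  by rewrite /x; field; rewrite gt_eqF.
apply: (@le_trans _ _ (2 * (expR 1 * eps))); first by rewrite ler_pM2l.
rewrite mulrA mulrC -ler_pdivlMr ?mulr_gt0 ?expR_gt0 //.
by rewrite ge_min lexx orbT.
Unshelve. all: by end_near.
Qed.
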